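(* Let $\mathbb{F}\in\{\mathbb{R},\mathbb{C}\}$, let $\mathcal{X}=\mathrm{span}\{X_1,\dots,X_k\}\subset\mathbb{F}^{n\times n}$ be a $k$-dimensional subspace, let $Y\in\mathbb{F}^{n\times n}\setminus\mathcal{X}$, and let $X_*\in\mathcal{X}$ be a spectral approximation of $Y$ from $\mathcal{X}$, i.e., $\|Y-X_*\|_2=\min_{X\in\mathcal{X}}\|Y-X\|_2$. Then $$\max_{v\in\mathbb{F}^n,\ \|v\|_2=1}\ \min_{X\in\mathcal{X}}\|(Y-X)v\|_2=\min_{X\in\mathcal{X}}\ \max_{v\in\mathbb{F}^n,\ \|v\|_2=1}\|(Y-X)v\|_2$$ if one of the following conditions holds: (1) $k=1$. (2) $\dim(\Sigma_{Y-X_*})=1$. (3) $k=2$, $\mathbb{F}=\mathbb{R}$, and $\dim(\Sigma_{Y-X_*})\ge 3$.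
   Context: $\|v\|_2=(v^Hv)^{1/2}$ is the Euclidean norm on $\mathbb{F}^n$ and $\|A\|_2=\max_{v\in\mathbb{F}^n,\,\|v\|_2=1}\|Av\|_2$ is the spectral norm on $\mathbb{F}^{n\times n}$. $\Sigma_{Y-X_*}\subseteq\mathbb{F}^n$ denotes the span (over $\mathbb{F}$) of the maximal right singular vectors of $Y-X_*$, i.e., of the right singular vectors corresponding to the maximal singular value $\|Y-X_*\|_2$ of $Y-X_*$. *)

(* Defs.v *)
From mathcomp Require Import all_boot all_order all_algebra.
From mathcomp Require Import boolp classical_sets reals.
From mathcomp Require Import complex.

Set Implicit Arguments.
Unset Strict Implicit.
Unset Printing Implicit Defensive.
Import Order.TTheory GRing.Theory Num.Theory.

Local Open Scope classical_set_scope.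
Local Open Scope ring_scope.

(* The base field is the real or the complex field. *)
Variant field_kind := OverReals | OverComplexes.

Definition base_field (R : realType) (K : field_kind) : numFieldType :=
  match K with OverReals => R | OverComplexes => R[i] end.

Definition base_conj (R : realType) (K : field_kind) : base_field R K -> base_field R K :=
  match K with OverReals => fun x => x | OverComplexes => fun z => conjc z end.

Definition real_part (R : realType) (K : field_kind) : base_field R K -> R :=
  match K with OverReals => fun x => x | OverComplexes => fun z => complex.Re z end.

Definition of_real (R : realType) (K : field_kind) : R -> base_field R K :=
  match K with OverReals => fun x => x | OverComplexes => fun x => (x%:C)%C end.

Definition is_max (R : realType) (S : set R) (m : R) : Prop := S m /\ ubound S m.
Definition is_min (R : realType) (S : set R) (m : R) : Prop := S m /\ lbound S m.

(* Attained extrema; both default to 0 when the extremum is not attained. *)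
Definition setmax (R : realType) (S : set R) : R := xget 0 [set m | is_max S m].
Definition setmin (R : realType) (S : set R) : R := xget 0 [set m | is_min S m].

Lemma setmaxE (R : realType) (S : set R) (m : R) : is_max S m -> setmax S = m.
Proof.
move=> [Sm um]; apply: xget_unique => // m' [Sm' um'].
by apply/eqP; rewrite eq_le um //= um'.
Qed.

Lemma setminE (R : realType) (S : set R) (m : R) : is_min S m -> setmin S = m.
Proof.
move=> [Sm lm]; apply: xget_unique => // m' [Sm' lm'].
by apply/eqP; rewrite eq_le lm' //= lm.
Qed.

Definition is_span (F : fieldType) (V : vectType F) (S : set V) (U : {vspace V}) :=
  forall v, v \in U <->
    exists s : seq V, (forall x, x \in s -> S x) /\ v \in <<s>>%VS.

Definition spanset (F : fieldType) (V : vectType F) (S : set V) : {vspace V} :=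
  xget 0%VS [set U | is_span S U].

Lemma spansetP (F : fieldType) (V : vectType F) (S : set V) :
  is_span S (spanset S).
Proof.
rewrite /spanset; case: xgetP => [U -> //|noU]; exfalso.
pose D d := `[< exists s : seq V, (forall x, x \in s -> S x) /\ \dim <<s>>%VS = d >].
have exD : exists d, D d.
  by exists (\dim <<([::] : seq V)>>%VS); apply/asboolP; exists [::].
have leD d : D d -> (d <= \dim {:V})%N.
  by move=> /asboolP[s [_ <-]]; apply: dimvS; apply: subvf.
case: (ex_maxnP exD leD) => d /asboolP[s [sS sd]] dmax.
apply: (noU <<s>>%VS) => v; split => [vs|[t [tS vt]]]; first by exists s.
have sub : (<<s>> <= <<s ++ t>>)%VS by rewrite span_cat addvSl.
have /eqP -> : (<<s>> == <<s ++ t>>)%VS.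
  rewrite eqEdim sub /= sd; apply: dmax; apply/asboolP; exists (s ++ t).
  by split=> // x; rewrite mem_cat => /orP[/sS|/tS].
by rewrite span_cat; apply: (subvP (addvSr _ _)).
Qed.

Section SpectralApproximation.
Variables (R : realType) (K : field_kind).
Local Notation F := (base_field R K).

Definition adjointmx (m n : nat) (A : 'M[F]_(m, n)) : 'M[F]_(n, m) :=
  (map_mx (@base_conj R K) A)^T.

Definition l2norm (n : nat) (v : 'cV[F]_n) : R :=
  Num.sqrt (real_part ((adjointmx v *m v) 0 0)).

Definition unit_sphere (n : nat) : set 'cV[F]_n := [set v | l2norm v = 1].

Definition spectral_norm (n : nat) (A : 'M[F]_n) : R :=
  setmax [set l2norm (A *m v) | v in @unit_sphere n].

Definition right_singular_vector (n : nat) (A : 'M[F]_n) (sigma : R)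
    (v : 'cV[F]_n) : Prop :=
  exists u : 'cV[F]_n,
    [/\ l2norm u = 1, l2norm v = 1,
        A *m v = of_real K sigma *: u &
        adjointmx A *m u = of_real K sigma *: v].

Definition max_right_singular_space (n : nat) (A : 'M[F]_n) : {vspace 'cV[F]_n} :=
  spanset [set v | right_singular_vector A (spectral_norm A) v].

Definition spectral_approximation (n : nat) (X : {vspace 'M[F]_n})
    (Y Xs : 'M[F]_n) : Prop :=
  Xs \in X /\
  is_min [set spectral_norm (Y - Z) | Z in [set` X]] (spectral_norm (Y - Xs)).

End SpectralApproximation.

(* Main.v *)
Require Import Defs.
From HB Require Import structures.
From mathcomp Require Import all_boot all_order all_algebra.
From mathcomp Require Import boolp classical_sets reals.
From mathcomp Require Import complex.
From mathcomp Require Import topology normedtype derive.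
From mathcomp Require Import ring lra.

Set Implicit Arguments.
Unset Strict Implicit.
Unset Printing Implicit Defensive.
Import Order.TTheory GRing.Theory Num.Theory.
Import numFieldNormedType.Exports.

Local Open Scope classical_set_scope.
Local Open Scope ring_scope.

(** Write [A = Y - Xstar] for the residual, [s] for its spectral norm, [E] for
    the span of its maximal right singular vectors and [dot u v] for the real
    part of the inner product.  The right-hand side of the identity is [s] by
    optimality of [Xstar], and the left-hand side is at most [s] because
    [Xstar] competes in every inner minimum.  Equality follows from a
    single nonzero [v] in [E] with [dot (A v) (Z v) = 0] for all [Z] in [X]:
    after normalizing [v], Pythagoras gives [|(Y - Z) v| >= |A v| = s]
    for all [Z] in [X] ([max_min_eq_min_max]).  Real parts suffice, so [X] and
    [E] may be regarded as real vector spaces, on which [v |-> dot (A v) (Z v)]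
    is a family of real quadratic forms, linear in [Z].

    What optimality says about this family is that none of its members is
    positive on all of [E] minus the origin ([descent_blocked]): otherwise
    [Xstar + t Z] would be a better approximation for small [t > 0].  The
    passage to the limit [t -> 0] is a compactness argument on quadratic forms
    ([first_order_zero]).  It remains to find a common zero of a real linear
    family of quadratic forms without positive definite member.

    - If [E] is a line over the base field, each form is a fixed multiple of
      the squared modulus of the coordinate; the multiple is [<= 0] for [Z] and
      for [- Z], hence zero.
    - A family spanned by one form takes values [<= 0] and values [>= 0], and the
      quadratic equation along a line provides a zero ([single_zero]).
    - A family spanned by two forms in at least three variables has a common
      zero ([common_zero]).  If [Q2] has constant strict sign on the
      nonzero zeros of [Q1], Finsler's lemma ([finsler]) yields a definite
      combination.  Otherwise [Q2] changes sign on the isotropic cone of [Q1],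
      and inside a three-dimensional subspace two points of that cone can be
      joined by an arc of a conic lying on it; the intermediate value theorem
      finds a zero of [Q2] on the arc ([common_zero_of_isotropic_pair]).

    The real case [k = 1] uses one form, the real case [k = 2] two forms in
    [dim E >= 3] variables.  In the complex case [k = 1], the space [X] is
    spanned over the reals by [Z1] and [i Z1], giving two forms in
    [2 dim E >= 4] variables unless [E] is a line. *)

(** * Real quadratic forms and compactness of the unit sphere *)

Section QuadraticForms.
Variables (R : realType) (m : nat).
Implicit Types (Q : 'M[R]_m) (x y z : 'rV[R]_m) (a b t : R).

Definition bform Q x y : R := (x *m Q *m y^T) 0 0.
Definition qform Q x : R := bform Q x x.
Definition polar Q x y : R := bform Q x y + bform Q y x.

Lemma bformDl Q x y z : bform Q (x + y) z = bform Q x z + bform Q y z.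
Proof. by rewrite /bform !mulmxDl mxE. Qed.

Lemma bformDr Q x y z : bform Q x (y + z) = bform Q x y + bform Q x z.
Proof. by rewrite /bform linearD mulmxDr mxE. Qed.

Lemma bformZl Q a x y : bform Q (a *: x) y = a * bform Q x y.
Proof. by rewrite /bform -!scalemxAl mxE. Qed.

Lemma bformZr Q a x y : bform Q x (a *: y) = a * bform Q x y.
Proof. by rewrite /bform linearZ /= -scalemxAr mxE. Qed.

Definition bformE := (bformDl, bformDr, bformZl, bformZr).

Lemma qformZ Q a x : qform Q (a *: x) = a ^+ 2 * qform Q x.
Proof. by rewrite /qform !bformE; ring. Qed.

Lemma qform_comb Q a b x y : qform Q (a *: x + b *: y) =
  a ^+ 2 * qform Q x + a * b * polar Q x y + b ^+ 2 * qform Q y.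
Proof. by rewrite /qform /polar !bformE; ring. Qed.

Lemma qformD Q1 Q2 x : qform (Q1 + Q2) x = qform Q1 x + qform Q2 x.
Proof. by rewrite /qform /bform mulmxDr mulmxDl mxE. Qed.

Lemma qformZm a Q x : qform (a *: Q) x = a * qform Q x.
Proof. by rewrite /qform /bform -scalemxAr -scalemxAl mxE. Qed.

Lemma qformN Q x : qform (- Q) x = - qform Q x.
Proof. by rewrite -scaleN1r qformZm mulN1r. Qed.

Lemma qform_continuous Q : continuous (qform Q).
Proof.
have -> : qform Q = fun x => \sum_j (\sum_i x 0 i * Q i j) * x 0 j.
  apply/funext => x; rewrite /qform /bform !mxE; apply: eq_bigr => j _.
  by rewrite !mxE.
apply: continuous_big => //= [|j _ x].
  by apply: add_continuous.
apply: continuousM; last exact: coord_continuous.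
apply: (continuous_big (P := predT)) => //= [|i _ y].
  by apply: add_continuous.
by apply: continuousM; [exact: coord_continuous | exact: cst_continuous].
Qed.

Lemma norm_qform_continuous Q : continuous (fun x => `|qform Q x|).
Proof. by move=> x; apply: (@cvg_norm _ _ _ (nbhs x)); apply: qform_continuous. Qed.

(** The sphere of the maximum norm: quadratic forms are homogeneous, so any
    compact set meeting every ray serves as well as the Euclidean sphere. *)
Definition sphere : set 'rV[R]_m := [set x | `|x| = 1].

Lemma compact_sphere : compact sphere.
Proof.
apply: bounded_closed_compact.
  exists 1; split => // r r1 x; rewrite /sphere /= => ->; exact: ltW.
have -> : sphere = (fun x => `|x|) @^-1` [set 1] by [].
by apply: preimage_closed => [x _|]; [exact: norm_continuous | exact: closed_eq].
Qed.

Lemma sphere_neq0 x : sphere x -> x != 0.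
Proof. by rewrite /sphere /= -normr_eq0 => ->; rewrite oner_eq0. Qed.

Lemma normalize_sphere x : x != 0 -> sphere (`|x|^-1 *: x).
Proof.
by move=> x0; rewrite /sphere /= normrZ normfV normr_id mulVf ?normr_eq0.
Qed.

Lemma qform_normalize x : x != 0 -> exists y c,
  [/\ sphere y, 0 < c & forall Q, qform Q y = c * qform Q x].
Proof.
move=> x0; exists (`|x|^-1 *: x), (`|x|^-1 ^+ 2); split=> [||Q].
- exact: normalize_sphere.
- by rewrite exprn_gt0 // invr_gt0 normr_gt0.
- by rewrite qformZ.
Qed.

Lemma sphere_min (f : 'rV[R]_m -> R) x0 : x0 != 0 -> {in sphere, continuous f} ->
  exists2 x, sphere x & forall y, sphere y -> f x <= f y.
Proof.
move=> x00 fc.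
have [|c cS cmin] := EVT_min_rV (f := f) _ compact_sphere
  (continuous_in_subspaceT fc).
  by exists (`|x0|^-1 *: x0); exact: normalize_sphere.
by exists c; [exact/set_mem | move=> y yS; apply: cmin; exact/mem_set].
Qed.

(** Approximate solutions of a closed condition on a compact set yield an
    exact one; every limiting argument below has this form. *)
Lemma sphere_approx (f : 'rV[R]_m -> R) : continuous f ->
    (forall e, 0 < e -> exists2 x, sphere x & f x <= e) ->
  exists2 x, sphere x & f x <= 0.
Proof.
move=> fc fe; have [x1 x1S _] := fe 1 ltr01.
have [x xS xmin] := sphere_min (sphere_neq0 x1S) (fun x _ => fc x).
exists x => //; apply/ler_addgt0Pr => e e0; rewrite add0r.
by have [y yS] := fe e e0; apply: le_trans; exact: xmin.
Qed.

Lemma qform_bounded Q : exists2 B, 0 < B & forall x, sphere x -> `|qform Q x| <= B.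
Proof.
have [[x0 x00]|no] := pselect (exists x0 : 'rV[R]_m, x0 != 0); last first.
  by exists 1 => // x /sphere_neq0 x0; case: no; exists x.
have [|x xS xmin] := @sphere_min (fun x => - `|qform Q x|) x0 x00.
  by move=> x _; apply: (@cvgN _ _ _ (nbhs x)); apply: norm_qform_continuous.
exists (`|qform Q x| + 1) => [|y yS]; first by rewrite ltr_wpDl.
by rewrite -lerN2; apply: le_trans (xmin _ yS); rewrite lerN2 lerDl.
Qed.

(** The quotient [Q / P] of a quadratic form by a positive definite one is
    constant along rays, hence attains its maximum. *)
Lemma max_ratio P Q x0 : x0 != 0 -> (forall x, x != 0 -> 0 < qform P x) ->
  exists2 x, x != 0 & forall y, qform Q y * qform P x <= qform Q x * qform P y.
Proof.
move=> x00 P0.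
have [|x xS xmin] := @sphere_min (fun x => - (qform Q x / qform P x)) x0 x00.
  move=> x /set_mem/sphere_neq0/P0 Px; apply: (@cvgN _ _ _ (nbhs x)).
  apply: (@cvgM _ _ (nbhs x)); first exact: qform_continuous.
  by apply: (@cvgV _ _ (nbhs x)); [rewrite gt_eqF | exact: qform_continuous].
have x0' := sphere_neq0 xS; exists x => // y.
have [->|/[dup] y0 /qform_normalize[z [c [zS c0 zE]]]] := eqVneq y 0.
  by rewrite -(scale0r 0) !qformZ expr0n !mul0r mulr0.
have := xmin z zS; rewrite !zE lerN2 -mulf_div divff ?gt_eqF // mul1r.
by rewrite ler_pdivrMr ?P0 // mulrAC ler_pdivlMr ?P0.
Qed.

(** On the unit sphere, a solution at parameter [t] satisfies [P x <= C t],
    and also [H x <= C t] because [P x] is nonnegative and can be dropped before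
    dividing by [t]; compactness then allows [t] to tend to [0]. *)
Lemma first_order_zero P H D : 
    (forall t, 0 < t ->
      exists2 x, x != 0 & qform P x + 2 * t * qform H x <= t ^+ 2 * qform D x) ->
    (forall x, 0 <= qform P x) ->
  exists2 x, x != 0 & qform P x <= 0 /\ qform H x <= 0.
Proof.
move=> hyp P0.
have [BH BH0 BHP] := qform_bounded H; have [BD BD0 BDP] := qform_bounded D.
have [| |x xS] := @sphere_approx (qform P \max qform H).
- by apply: max_fun_continuous; exact: qform_continuous.
- move=> e e0.
  (* With t <= 1 and t (BD + 2 BH) <= e, both forms are at most e. *)
  pose t := Num.min 1 (e / (BD + 2 * BH)).
  have B0 : 0 < BD + 2 * BH by lra.
  have t0 : 0 < t by rewrite lt_min ltr01 divr_gt0.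
  have t1 : t <= 1 by rewrite ge_min lexx.
  have te : t * (BD + 2 * BH) <= e by rewrite -ler_pdivlMr // ge_min lexx orbT.
  have [x x0 xP] := hyp t t0; have [y [c [yS c0 yE]]] := qform_normalize x0.
  exists y => //.
  have yP : qform P y + 2 * t * qform H y <= t ^+ 2 * qform D y.
    rewrite !yE -subr_ge0.
    have -> : t ^+ 2 * (c * qform D x) - (c * qform P x + 2 * t * (c * qform H x))
      = c * (t ^+ 2 * qform D x - (qform P x + 2 * t * qform H x)) by ring.
    by rewrite mulr_ge0 ?subr_ge0 // ltW.
  have /ler_normlP[_ Dy] := BDP _ yS; have /ler_normlP[Hy _] := BHP _ yS.
  have Py := P0 y.
  have tD : t ^+ 2 * qform D y <= t * BD.
    by rewrite expr2 -mulrA ler_pM2l //; nra.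
  have tH : t * (- qform H y) <= t * BH by rewrite ler_pM2l.
  rewrite /= ge_max; apply/andP; split; first by nra.
  have : t * (2 * qform H y) <= t * (t * qform D y) by nra.
  by rewrite ler_pM2l //; nra.
rewrite /= ge_max => /andP[Px Hx].
by exists x => //; exact: sphere_neq0.
Qed.

(** If [Q] has strictly opposite signs at [x] and [y], it has two zeros of the
    form [x + t *: y], one with [t > 0] and one with [t < 0].  Choosing the sign of [t]
    opposite to that of the mixed term of [G] keeps [G] nonpositive. *)
Lemma isotropic_between Q G x y : x != 0 -> y != 0 ->
    qform Q y <= 0 <= qform Q x -> qform G x <= 0 -> qform G y <= 0 ->
  exists a b, let z := a *: x + b *: y in
    [/\ z != 0, qform Q z = 0 & qform G z <= 0].
Proof.
move=> x0 y0 /andP[]; rewrite le_eqVlt => /orP[/eqP Qy|Qy].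
  by exists 0, 1; rewrite scale0r add0r scale1r.
rewrite le_eqVlt => /orP[/eqP/esym Qx|Qx].
  by exists 1, 0; rewrite scale0r addr0 scale1r.
move=> Gx Gy; set b := polar Q x y; set c := polar G x y.
pose s := Num.sqrt (b ^+ 2 - 4 * qform Q x * qform Q y).
have D0 : 0 <= b ^+ 2 - 4 * qform Q x * qform Q y by nra.
have s2 : s ^+ 2 = b ^+ 2 - 4 * qform Q x * qform Q y by rewrite sqr_sqrtr.
have s0 : 0 <= s by rewrite sqrtr_ge0.
have [t [Qt ct]] : exists t, qform Q x + t * b + t ^+ 2 * qform Q y = 0 /\ t * c <= 0.
  have Qyn : qform Q y != 0 by rewrite lt_eqF.
  have sb : `|b| < s.
    by rewrite -(@ltr_pXn2r _ 2) ?nnegrE // s2 real_normK ?num_real //; nra.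
  have /ltr_normlP[sb1 sb2] := sb.
  have iQ : (2 * qform Q y)^-1 < 0 by rewrite invr_lt0; lra.
  have root (u : R) : u ^+ 2 = s ^+ 2 ->
      let t := (- b + u) * (2 * qform Q y)^-1 in
      qform Q x + t * b + t ^+ 2 * qform Q y = 0.
    move=> u2 /=.
    have -> : qform Q x = (b ^+ 2 - u ^+ 2) / (4 * qform Q y).
      by rewrite u2 s2; field.
    by field.
  have [c0|c0] := leP 0 c.
    exists ((- b + s) * (2 * qform Q y)^-1); split; first exact: root.
    by apply: mulr_le0_ge0 c0; apply: mulr_ge0_le0 (ltW iQ); lra.
  exists ((- b + - s) * (2 * qform Q y)^-1); split; last first.
    by apply: mulr_ge0_le0 (ltW c0); apply: mulr_le0 (ltW iQ); lra.
  by apply: root; rewrite sqrrN.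
exists 1, t; split; first apply/negP => /eqP z0.
  have xt : x = - t *: y.
    by rewrite scaleNr; apply/eqP; rewrite -addr_eq0 -{1}(scale1r x) z0.
  by move: Qx; rewrite xt qformZ sqrrN; nra.
  by rewrite qform_comb -/b -Qt; ring.
by rewrite qform_comb -/c; nra.
Qed.

(** [blocked Q1 Q2 l]: the form [Q2 + l Q1] fails to be positive at a point
    where decreasing [l] does not help. *)
Definition blocked Q1 Q2 l :=
  exists2 x, x != 0 & 0 <= qform Q1 x /\ qform Q2 x + l * qform Q1 x <= 0.

Lemma blocked_sphere Q1 Q2 l : blocked Q1 Q2 l ->
  exists2 x, sphere x & 0 <= qform Q1 x /\ qform Q2 x + l * qform Q1 x <= 0.
Proof.
case=> x x0 [Q1x Q2x]; have [y [c [yS c0 yE]]] := qform_normalize x0.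
by exists y => //; rewrite !yE; split; nra.
Qed.

(** If [l] could be arbitrarily large, [0 <= Q1 x <= |Q2 x| / l] would force
    a limit point with [Q1 x = 0] and [Q2 x <= 0]. *)
Lemma blocked_bounded Q1 Q2 :
    (forall x, x != 0 -> qform Q1 x = 0 -> 0 < qform Q2 x) ->
  exists L, forall l, blocked Q1 Q2 l -> l <= L.
Proof.
move=> iso; apply/not_existsP => noL.
have [B B0 BP] := qform_bounded Q2.
have [| |x xS] := @sphere_approx ((fun x => `|qform Q1 x|) \max qform Q2).
- by apply: max_fun_continuous;
    [exact: norm_qform_continuous | exact: qform_continuous].
- move=> e e0; have /existsNP[l /not_implyP[/blocked_sphere[x xS [Q1x Q2x]]]] := noL (B / e).
  move=> /negP; rewrite -ltNge => lB; exists x => //.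
  have Be : 0 < B / e by rewrite divr_gt0.
  have /ler_normlP[Q2B _] := BP _ xS.
  rewrite /= ge_max ger0_norm //; apply/andP; split; last by nra.
  have : B / e * qform Q1 x <= B by nra.
  by rewrite mulrAC ler_pdivrMr // ler_pM2l.
rewrite /= ge_max normr_le0 => /andP[/eqP Q1x].
by rewrite leNgt iso //; exact: sphere_neq0.
Qed.

Lemma blocked_closed Q1 Q2 l :
    (forall e, 0 < e -> exists2 l', `|l - l'| <= e & blocked Q1 Q2 l') ->
  blocked Q1 Q2 l.
Proof.
move=> hyp; have [B B0 BP] := qform_bounded Q1.
have [| |x xS] := @sphere_approx (qform (- Q1) \max qform (Q2 + l *: Q1)).
- by apply: max_fun_continuous; exact: qform_continuous.
- move=> e e0; have [|l' ll' /blocked_sphere[x xS [Q1x Q2x]]] := hyp (e / B).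
    by rewrite divr_gt0.
  exists x => //; have /ler_normlP[_ Q1B] := BP _ xS.
  rewrite /= ge_max qformN qformD qformZm; apply/andP; split; first by lra.
  have /ler_normlP[_ ll1] := ll'.
  have eB : e / B * B = e by rewrite divfK ?gt_eqF.
  have : 0 < e / B by rewrite divr_gt0.
  by nra.
rewrite /= ge_max qformN qformD qformZm oppr_le0 => /andP[Q1x Q2x].
by exists x => //; exact: sphere_neq0.
Qed.

(** Finsler's lemma.  If no [l] works, each [l] is blocked from the side
    [0 <= Q1] or from the side [Q1 <= 0].  Both sets of parameters are closed
    and bounded from above, respectively below, so the supremum [l] of the
    first one belongs to both.  At this [l] the form [Q2 + l Q1] is nonpositive
    at a point with [0 <= Q1] and at one with [Q1 <= 0], hence by
    [isotropic_between] at a zero of [Q1], where it equals [Q2]. *)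
Lemma finsler Q1 Q2 :
    (forall x, x != 0 -> qform Q1 x = 0 -> 0 < qform Q2 x) ->
  exists l, forall x, x != 0 -> 0 < qform Q2 x + l * qform Q1 x.
Proof.
move=> iso; apply/not_existsP => noL.
have total l : blocked Q1 Q2 l \/ blocked (- Q1) Q2 (- l).
  have /existsNP[x /not_implyP[x0 /negP]] := noL l; rewrite -leNgt => xl.
  have [Q1x|/ltW Q1x] := leP 0 (qform Q1 x); [left|right]; exists x => //.
  by rewrite qformN; split; lra.
have [L LP] := blocked_bounded iso.
have [|L' LP'] := @blocked_bounded (- Q1) Q2.
  by move=> x x0; rewrite qformN => /eqP; rewrite oppr_eq0 => /eqP; exact: iso.
pose S := [set l | blocked Q1 Q2 l].
have supS : has_sup S.
  split; last by exists L => l; exact: LP.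
  exists (- (L' + 1)); case: (total (- (L' + 1))) => // /LP'; lra.
have pos : blocked Q1 Q2 (sup S).
  apply: blocked_closed => e e0; have [l Sl ll] := sup_adherent e0 supS.
  exists l => //; have := ub_le_sup (proj2 supS) Sl => lS.
  by rewrite ger0_norm; lra.
have neg : blocked (- Q1) Q2 (- sup S).
  apply: blocked_closed => e e0; exists (- (sup S + e)).
    by rewrite ger0_norm; lra.
  by case: (total (sup S + e)) => // Sl; have := ub_le_sup (proj2 supS) Sl; lra.
have [x x0 [Q1x Q2x]] := pos; have [y y0 [Q1y Q2y]] := neg.
rewrite qformN in Q1y Q2y.
have [|||a [b [z0 Q1z]]] := @isotropic_between Q1 (Q2 + sup S *: Q1) x y x0 y0.
- by rewrite Q1x; lra.
- by rewrite qformD qformZm.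
- by rewrite qformD qformZm; lra.
by rewrite qformD qformZm Q1z mulr0 addr0 leNgt iso.
Qed.

Lemma polarDr Q x y z : polar Q x (y + z) = polar Q x y + polar Q x z.
Proof. by rewrite /polar !bformE; ring. Qed.

Lemma polarZr Q a x y : polar Q x (a *: y) = a * polar Q x y.
Proof. by rewrite /polar !bformE; ring. Qed.

Lemma polarC Q x y : polar Q x y = polar Q y x.
Proof. exact: addrC. Qed.

Lemma polarxx Q x : polar Q x x = 2 * qform Q x.
Proof. by rewrite /polar /qform; ring. Qed.

Lemma outside_plane x y : (2 < m)%N -> exists u, forall a b, u != a *: x + b *: y.
Proof.
move=> m2; have : ~~ row_full (col_mx x y).
  by rewrite /row_full neq_ltn (leq_ltn_trans (rank_leq_row _)).
rewrite -sub1mx => /row_subPn[i ni]; exists (row i 1%:M) => a b.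
apply: contraNneq ni => ->; apply/submxP; exists (row_mx a%:M b%:M).
by rewrite mul_row_col !mul_scalar_mx.
Qed.

(** If [x] and [y] are orthogonal for [Q1], then [Q1] vanishes on the plane
    they span and the sign change of [Q2] gives a zero in that plane.
    Otherwise complete them by a vector [w] orthogonal to both for [Q1]; the
    isotropic cone of [Q1] in the span is [b * p * q + g * r ^+ 2 = 0] in
    coordinates [p, q, r].  For [g = 0] it contains the planes through [w];
    for [g != 0] it is a cone over a conic, which can be parametrized
    rationally from [x] to [y]. *)
Lemma common_zero_of_isotropic_pair Q1 Q2 x y : (2 < m)%N ->
    qform Q1 x = 0 -> qform Q1 y = 0 -> qform Q2 y < 0 < qform Q2 x ->
  exists2 z, z != 0 & qform Q1 z = 0 /\ qform Q2 z = 0.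
Proof.
move=> m2 Q1x Q1y /andP[Q2y Q2x].
have qform0 Q : qform Q 0 = 0 by rewrite -(scale0r 0) qformZ expr0n mul0r.
have nz Q v : qform Q v != 0 -> v != 0 by apply: contraNneq => ->; rewrite qform0.
have plane u v : qform Q1 u = 0 -> qform Q1 v = 0 -> polar Q1 u v = 0 ->
    u != 0 -> v != 0 -> qform Q2 v <= 0 <= qform Q2 u ->
    exists2 z, z != 0 & qform Q1 z = 0 /\ qform Q2 z = 0.
  move=> Q1u Q1v uv u0 v0 Q2uv.
  have [||a [b [z0 Q2z _]]] := @isotropic_between Q2 Q1 u v u0 v0 Q2uv.
  - by rewrite Q1u.
  - by rewrite Q1v.
  exists (a *: u + b *: v) => //; split=> //.
  by rewrite qform_comb Q1u Q1v uv; ring.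
have x0 : x != 0 by apply: (nz Q2); rewrite gt_eqF.
have y0 : y != 0 by apply: (nz Q2); rewrite lt_eqF.
set b := polar Q1 x y.
have [b0|b0] := eqVneq b 0; first by apply: (plane x y); rewrite // !ltW.
have [u uP] := outside_plane x y m2.
pose w := u + (- (polar Q1 u y / b)) *: x + (- (polar Q1 u x / b)) *: y.
have wP c d : w != c *: x + d *: y.
  have := uP (c + polar Q1 u y / b) (d + polar Q1 u x / b).
  apply: contraNneq => wE.
  by apply/eqP; rewrite !scalerDl addrACA -wE /w !scaleNr -(addrA u) -opprD subrK.
have wx : polar Q1 x w = 0.
  rewrite !polarDr !polarZr polarxx Q1x -/b (polarC _ x u); field.
  by rewrite b0.
have wy : polar Q1 y w = 0.
  rewrite !polarDr !polarZr polarxx Q1y (polarC _ y x) -/b (polarC _ y u); field.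
  by rewrite b0.
clearbody w; have w0 : w != 0 by have := wP 0 0; rewrite !scale0r addr0.
have [g0|g0] := eqVneq (qform Q1 w) 0.
  have [Q2w|/ltW Q2w] := leP 0 (qform Q2 w).
    by apply: (plane w y); rewrite // ?(polarC _ w) // Q2w ltW.
  by apply: (plane x w); rewrite // Q2w ltW.
(* The conic arc v runs from x at t = 0 to k *: y at t = 1. *)
pose k := - qform Q1 w / b.
have k0 : k != 0 by rewrite mulf_neq0 ?oppr_eq0 ?invr_eq0.
pose v t := ((1 - t) ^+ 2) *: x + 1 *: ((k * t ^+ 2) *: y + ((1 - t) * t) *: w).
have Q1v t : qform Q1 (v t) = 0.
  rewrite !qform_comb Q1x Q1y polarDr !polarZr wx wy -/b /k; field.
  by rewrite b0.
have v0 t : v t != 0.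
  apply/negP; rewrite /v scale1r => /eqP v0.
  have [t1|t1] := eqVneq t 1.
    move: v0; rewrite t1 subrr expr0n /= mul0r !scale0r add0r addr0 expr1n mulr1.
    by move/eqP; rewrite scaler_eq0 (negPf k0) (negPf y0).
  have t1' : 1 - t != 0 by rewrite subr_eq0 eq_sym.
  have [t0|t0] := eqVneq t 0.
    move: v0; rewrite t0 subr0 expr0n /= !mulr0 !scale0r !addr0 expr1n scale1r.
    by move/eqP; rewrite (negPf x0).
  have := wP (- ((1 - t) / t)) (- (k * t / (1 - t))); rewrite -subr_eq0.
  have -> : w - (- ((1 - t) / t) *: x + - (k * t / (1 - t)) *: y) =
     ((1 - t) * t)^-1 *: (((1 - t) ^+ 2) *: x + ((k * t ^+ 2) *: y + ((1 - t) * t) *: w)).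
    rewrite !scalerDr !scalerA mulVf ?mulf_neq0 // scale1r opprD !scaleNr !opprK.
    rewrite [LHS]addrC [RHS]addrA; congr (_ *: _ + _ *: _ + _); field; exact/andP.
  by rewrite v0 scaler0 eqxx.
pose p : {poly R} :=
  ((1 - 'X) ^+ 4) * (qform Q2 x)%:P + (1 - 'X) ^+ 2 * k%:P * 'X ^+ 2 * (polar Q2 x y)%:P
  + (1 - 'X) ^+ 3 * 'X * (polar Q2 x w)%:P + k%:P ^+ 2 * 'X ^+ 4 * (qform Q2 y)%:P
  + k%:P * 'X ^+ 3 * (1 - 'X) * (polar Q2 y w)%:P
  + (1 - 'X) ^+ 2 * 'X ^+ 2 * (qform Q2 w)%:P.
have pE t : p.[t] = qform Q2 (v t).
  rewrite !qform_comb polarDr !polarZr /p.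
  by rewrite !(hornerD, hornerN, hornerM, horner_exp, hornerX, hornerC); ring.
have [|t _ /rootP pt] := @poly_ivt R (- p) 0 1 ler01; last first.
  exists (v t) => //; split=> //.
  by rewrite -pE; apply/eqP; rewrite -oppr_eq0 -hornerN pt.
rewrite !hornerN !pE /v subr0 subrr; apply/andP; split.
  rewrite expr0n /= !mulr0 !scale0r addr0 scaler0 addr0 expr1n scale1r.
  by rewrite oppr_le0 ltW.
rewrite expr0n /= mul0r !scale0r add0r addr0 scale1r expr1n mulr1 qformZ.
by rewrite oppr_ge0 mulr_ge0_le0 ?sqr_ge0 // ltW.
Qed.

(** Without a common zero, [Q2] keeps a strict sign on the nonzero zeros of [Q1]
    by [common_zero_of_isotropic_pair], and [finsler] produces a combination
    that is positive definite, against the hypothesis.  The bound on the number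
    of variables is sharp: [x^2 - y^2] and [2 x y]
    have no definite combination and no common zero. *)
Lemma common_zero Q1 Q2 : (2 < m)%N ->
    (forall a b, exists2 x, x != 0 & a * qform Q1 x + b * qform Q2 x <= 0) ->
  exists2 x, x != 0 & qform Q1 x = 0 /\ qform Q2 x = 0.
Proof.
move=> m2 hyp; apply: contrapT => no.
have def Q : (forall x, x != 0 -> qform Q1 x = 0 -> 0 < qform Q x) ->
    (exists2 s, True & forall x, qform Q x = s * qform Q2 x) -> False.
  move=> /finsler[l lP] [s _ sE]; have [x x0] := hyp l s.
  by rewrite leNgt addrC -sE lP.
apply: (def Q2) => [x x0 Q1x|]; last by exists 1 => // x; rewrite mul1r.
rewrite ltNge; apply/negP => Q2x.
apply: (def (- Q2)) => [y y0 Q1y|]; last first.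
  by exists (- 1) => // y; rewrite qformN mulN1r.
rewrite qformN oppr_gt0 ltNge; apply/negP => Q2y; apply: no.
have [Q2y0|Q2y0] := eqVneq (qform Q2 y) 0; first by exists y.
have [Q2x0|Q2x0] := eqVneq (qform Q2 x) 0; first by exists x.
apply: (common_zero_of_isotropic_pair m2 Q1y Q1x).
by rewrite !lt_def Q2y0 Q2y eq_sym Q2x0 Q2x.
Qed.

Lemma single_zero Q :
    (forall a, exists2 x, x != 0 & a * qform Q x <= 0) ->
  exists2 x, x != 0 & qform Q x = 0.
Proof.
move=> hyp; have [x x0] := hyp (- 1); have [y y0] := hyp 1.
rewrite mul1r mulN1r oppr_le0 => Qy Qx.
have [|||a [b [z0 Qz _]]] := @isotropic_between Q 0 x y x0 y0.
- by rewrite Qy.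
- by rewrite /qform /bform mulmx0 mul0mx mxE.
- by rewrite /qform /bform mulmx0 mul0mx mxE.
by exists (a *: x + b *: y).
Qed.

End QuadraticForms.

(** * Real structure of the base field and of its column vectors *)

Section BaseField.
Variables (R : realType) (K : field_kind).
Local Notation F := (base_field R K).
Local Notation conj := (@base_conj R K).
Local Notation re := (@real_part R K).
Local Notation inj := (@of_real R K).

Lemma base_conj_is_zmod_morphism : zmod_morphism conj.
Proof. by case: K => x y //; exact: (rmorphB (@conjc R)). Qed.
Lemma base_conj_is_monoid_morphism : monoid_morphism conj.
Proof. by case: K; split=> // [|x y]; [exact: rmorph1 | exact: (rmorphM (@conjc R))]. Qed.
HB.instance Definition _ :=
  GRing.isZmodMorphism.Build F F conj base_conj_is_zmod_morphism.
HB.instance Definition _ :=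
  GRing.isMonoidMorphism.Build F F conj base_conj_is_monoid_morphism.

Lemma of_real_is_zmod_morphism : zmod_morphism inj.
Proof. by case: K => x y //; exact: (rmorphB (real_complex R)). Qed.
Lemma of_real_is_monoid_morphism : monoid_morphism inj.
Proof. by case: K; split=> // x y; exact: (rmorphM (real_complex R)). Qed.
HB.instance Definition _ :=
  GRing.isZmodMorphism.Build R F inj of_real_is_zmod_morphism.
HB.instance Definition _ :=
  GRing.isMonoidMorphism.Build R F inj of_real_is_monoid_morphism.

Lemma real_part_is_zmod_morphism : zmod_morphism re.
Proof. by case: K => [x y|[a b] [c d]]. Qed.
HB.instance Definition _ :=
  GRing.isZmodMorphism.Build F R re real_part_is_zmod_morphism.

Lemma base_conjK : involutive conj.
Proof. by case: K => // z; exact: conjcK. Qed.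

Lemma base_conj_of_real a : conj (inj a) = inj a.
Proof. by case: K => //=; rewrite oppr0. Qed.

Lemma real_partZ a z : re (inj a * z) = a * re z.
Proof. by case: K z => //= -[b c] /=; rewrite mul0r subr0. Qed.

Lemma real_part_conj z : re (conj z) = re z.
Proof. by case: K z => //= -[]. Qed.

Lemma conj_mul_real z : conj z * z = inj (re (conj z * z)).
Proof.
case: K z => //= -[a b] /=.
by apply/eqP; rewrite eq_complex /= eqxx /=; apply/eqP; ring.
Qed.

Lemma conj_mul_ge0 z : 0 <= re (conj z * z).
Proof.
case: K z => /= [z|[a b] /=]; first by rewrite -expr2 sqr_ge0.
by rewrite mulNr opprK addr_ge0 // -expr2 sqr_ge0.
Qed.

Lemma conj_mul_eq0 z : re (conj z * z) = 0 -> z = 0.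
Proof.
move=> z0; have /eqP := conj_mul_real z; rewrite z0 rmorph0 mulf_eq0 fmorph_eq0 orbb.
by move/eqP.
Qed.

Lemma real_part_of_real a : re (inj a) = a.
Proof. by case: K. Qed.

End BaseField.

Section InnerProduct.
Variables (R : realType) (K : field_kind).
Local Notation F := (base_field R K).
Local Notation inj := (@of_real R K).

(** The real part of the Hermitian inner product, which is a Euclidean inner
    product on the underlying real vector space. *)
Definition dot n (u v : 'cV[F]_n) : R := real_part ((adjointmx u *m v) 0 0).

Lemma adjointmxD m n (A B : 'M[F]_(m, n)) : adjointmx (A + B) = adjointmx A + adjointmx B.
Proof. by rewrite /adjointmx map_mxD linearD. Qed.

Lemma adjointmxM m n p (A : 'M[F]_(m, n)) (B : 'M_(n, p)) :
  adjointmx (A *m B) = adjointmx B *m adjointmx A.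
Proof. by rewrite /adjointmx map_mxM trmx_mul. Qed.

Lemma adjointmxZ m n (c : F) (A : 'M[F]_(m, n)) :
  adjointmx (c *: A) = base_conj c *: adjointmx A.
Proof. by rewrite /adjointmx map_mxZ linearZ. Qed.

Lemma adjointmxK m n (A : 'M[F]_(m, n)) : adjointmx (adjointmx A) = A.
Proof. by apply/matrixP => i j; rewrite !mxE base_conjK. Qed.

Lemma dotDl n (u v w : 'cV[F]_n) : dot (u + v) w = dot u w + dot v w.
Proof. by rewrite /dot adjointmxD mulmxDl mxE raddfD. Qed.

Lemma dotDr n (u v w : 'cV[F]_n) : dot u (v + w) = dot u v + dot u w.
Proof. by rewrite /dot mulmxDr mxE raddfD. Qed.

Lemma dotZl n a (u v : 'cV[F]_n) : dot (inj a *: u) v = a * dot u v.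
Proof. by rewrite /dot adjointmxZ base_conj_of_real -scalemxAl mxE real_partZ. Qed.

Lemma dotZr n a (u v : 'cV[F]_n) : dot u (inj a *: v) = a * dot u v.
Proof. by rewrite /dot -scalemxAr mxE real_partZ. Qed.

Lemma dotZZ n c (u v : 'cV[F]_n) :
  dot (c *: u) (c *: v) = real_part (base_conj c * c) * dot u v.
Proof.
rewrite /dot adjointmxZ -scalemxAl -scalemxAr !mxE mulrA conj_mul_real real_partZ.
by rewrite real_part_of_real.
Qed.

Lemma dotC n (u v : 'cV[F]_n) : dot u v = dot v u.
Proof.
rewrite /dot -real_part_conj; congr real_part.
by rewrite -{1}(adjointmxK v) -adjointmxM !mxE base_conjK.
Qed.

Lemma dot_adjoint m n (A : 'M[F]_(m, n)) u v : dot (A *m u) v = dot u (adjointmx A *m v).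
Proof. by rewrite /dot adjointmxM mulmxA. Qed.

Lemma dot_sum n (u : 'cV[F]_n) :
  dot u u = \sum_i real_part (base_conj (u i 0) * u i 0).
Proof. by rewrite /dot mxE raddf_sum; apply: eq_bigr => i _; rewrite !mxE. Qed.

Lemma dot_ge0 n (u : 'cV[F]_n) : 0 <= dot u u.
Proof. by rewrite dot_sum sumr_ge0 // => i _; exact: conj_mul_ge0. Qed.

Lemma dot_eq0 n (u : 'cV[F]_n) : dot u u = 0 -> u = 0.
Proof.
rewrite dot_sum => /eqP; rewrite psumr_eq0 => [/allP u0|i _]; last exact: conj_mul_ge0.
apply/colP => i; rewrite mxE; apply: conj_mul_eq0; apply/eqP.
by apply: u0; rewrite mem_index_enum.
Qed.

Lemma dot_gt0 n (u : 'cV[F]_n) : u != 0 -> 0 < dot u u.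
Proof. by move=> u0; rewrite lt_def dot_ge0 andbT; apply: contraNneq u0 => /dot_eq0 ->. Qed.

Lemma dotNr n (u v : 'cV[F]_n) : dot u (- v) = - dot u v.
Proof. by rewrite -scaleN1r -(rmorph1 inj) -rmorphN dotZr mulN1r. Qed.

Lemma dotNl n (u v : 'cV[F]_n) : dot (- u) v = - dot u v.
Proof. by rewrite dotC dotNr dotC. Qed.

Lemma l2norm_sqr n (v : 'cV[F]_n) : l2norm v ^+ 2 = dot v v.
Proof. by rewrite /l2norm sqr_sqrtr // dot_ge0. Qed.

Lemma l2norm_ge0 n (v : 'cV[F]_n) : 0 <= l2norm v.
Proof. exact: sqrtr_ge0. Qed.

Lemma l2norm_eq1 n (v : 'cV[F]_n) : l2norm v = 1 <-> dot v v = 1.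
Proof.
split=> [v1|v1]; first by rewrite -l2norm_sqr v1 expr1n.
by rewrite /l2norm -/(dot v v) v1 sqrtr1.
Qed.

Lemma l2norm_le n p (u : 'cV[F]_n) (v : 'cV[F]_p) :
  (l2norm u <= l2norm v) = (dot u u <= dot v v).
Proof. by rewrite ler_sqrt // dot_ge0. Qed.

Lemma normalize_unit n (v : 'cV[F]_n) : v != 0 ->
  exists2 c, c != 0 & dot (inj c *: v) (inj c *: v) = 1.
Proof.
move=> /dot_gt0 v0; exists (Num.sqrt (dot v v))^-1.
  by rewrite invr_eq0 gt_eqF // sqrtr_gt0.
rewrite dotZl dotZr mulrA -expr2 exprVn sqr_sqrtr ?dot_ge0 // mulVf //.
by rewrite gt_eqF.
Qed.

End InnerProduct.

(** * Real coordinates and attainment of the spectral norm *)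

Definition real_degree (K : field_kind) : nat :=
  match K with OverReals => 1 | OverComplexes => 2 end.

Section RealCoordinates.
Variables (R : realType) (K : field_kind).
Local Notation F := (base_field R K).
Local Notation inj := (@of_real R K).

Definition real_linear m (V : lmodType F) (f : 'rV[R]_m -> V) :=
  forall a x y, f (a *: x + y) = inj a *: f x + f y.

Lemma real_coordinates_row d : exists f : 'rV[R]_(real_degree K * d) -> 'rV[F]_d,
  [/\ real_linear f, forall x, f x = 0 -> x = 0 & forall v, exists x, f x = v].
Proof.
rewrite /real_linear; case: K => /=.
  have e : (1 * d = d)%N by rewrite mul1n.
  exists (castmx (erefl, e)); split=> [a x y|x x0|v].
  - by apply/rowP => i; rewrite !(castmxE, mxE).
  - apply/rowP => i; move/rowP/(_ (cast_ord e i)): x0.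
    by rewrite castmxE !mxE /= cast_ordK cast_ord_id.
  - by exists (castmx (erefl, esym e) v); rewrite castmxKV.
have e : (2 * d = d + d)%N by rewrite mul2n addnn.
pose g (x : 'rV[R]_(d + d)) : 'rV[R[i]]_d := 
  \row_i (x 0 (lshift d i) +i* x 0 (rshift d i))%C.
exists (fun x => g (castmx (erefl, e) x)); split=> [a x y|x x0|v].
- apply/rowP => i; rewrite !mxE !castmxE !mxE; apply/eqP.
  by rewrite eq_complex /= !mul0r subr0 addr0 !eqxx.
- suff y0 : castmx (erefl, e) x = 0.
    by rewrite -(castmxK (erefl 1%N) e x) y0; apply/rowP => i; rewrite castmxE !mxE.
  move: (castmx _ x) x0 => y /rowP y0; apply/rowP => i; rewrite mxE.
  by case: (split_ordP i) => j ->; have /eqP := y0 j;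
    rewrite !mxE eq_complex => /andP[/eqP /= + /eqP /= +].
- exists (castmx (erefl, esym e) (row_mx (\row_i complex.Re (v 0 i)) (\row_i complex.Im (v 0 i)))).
  apply/rowP => i; rewrite castmxKV [LHS]mxE row_mxEl row_mxEr !mxE.
  by case: (v 0 i).
Qed.

Lemma real_coordinates n (E : {vspace 'cV[F]_n}) :
  exists f : 'rV[R]_(real_degree K * \dim E) -> 'cV[F]_n,
  [/\ real_linear f, forall x, f x = 0 -> x = 0
    & forall v, v \in E <-> exists x, f x = v].
Proof.
have [g [glin ginj gsurj]] := real_coordinates_row (\dim E).
have bE := vbasisP E.
exists (fun x => \sum_i g x 0 i *: (vbasis E)`_i); split=> [a x y|x x0|v].
- rewrite scaler_sumr -big_split; apply: eq_bigr => i _ /=.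
  by rewrite glin !mxE scalerDl scalerA.
- have /freeP fr := basis_free bE.
  by apply: ginj; apply/rowP => i; rewrite mxE; exact: fr x0 i.
- split=> [vE|[x <-]].
    have [x gx] := gsurj (\row_i coord (vbasis E) i v); exists x.
    rewrite [RHS](coord_vbasis vE); apply: eq_bigr => i _.
    by rewrite gx mxE.
  by apply: memv_suml => i _; rewrite memvZ // vbasis_mem // mem_nth // size_tuple.
Qed.

Lemma real_linear0 m (V : lmodType F) (f : 'rV[R]_m -> V) : real_linear f -> f 0 = 0.
Proof.
by move=> fl; have := fl (-1) 0 0; rewrite scaler0 addr0 rmorphN1 scaleN1r addNr.
Qed.

Lemma real_linear_sum m (V : lmodType F) (f : 'rV[R]_m -> V) x :
  real_linear f -> f x = \sum_i inj (x 0 i) *: f (delta_mx 0 i).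
Proof.
move=> fl; have f0 := real_linear0 fl; rewrite {1}(row_sum_delta x).
by apply: (big_ind2 (fun u v => f u = v)) => [//|u1 v1 u2 v2 <- <-|i _];
  [rewrite -{1}(scale1r u1) fl rmorph1 scale1r | rewrite -[X in f X]addr0 fl f0 addr0].
Qed.

Lemma dot_suml n (I : finType) (u : I -> 'cV[F]_n) v :
  dot (\sum_i u i) v = \sum_i dot (u i) v.
Proof.
apply: (big_ind2 (fun u a => dot u v = a)) => // [|u1 a1 u2 a2 <- <-].
  by rewrite -(scale0r 0) -(rmorph0 inj) dotZl mul0r.
exact: dotDl.
Qed.

Lemma dot_sumr n (I : finType) (u : I -> 'cV[F]_n) v :
  dot v (\sum_i u i) = \sum_i dot v (u i).
Proof. by rewrite dotC dot_suml; apply: eq_bigr => i _; rewrite dotC. Qed.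

(** This is what reduces the geometry of matrices over either base field to
    real quadratic forms. *)
Lemma pullback_qform m n (f : 'rV[R]_m -> 'cV[F]_n) (A B : 'M[F]_n) : real_linear f ->
  exists Q, forall x, dot (A *m f x) (B *m f x) = qform Q x.
Proof.
move=> fl.
exists (\matrix_(i, j) dot (A *m f (delta_mx 0 i)) (B *m f (delta_mx 0 j))) => x.
rewrite (real_linear_sum x fl) !mulmx_sumr dot_sumr /qform /bform mxE.
apply: eq_bigr => j _; rewrite dot_suml !mxE big_distrl; apply: eq_bigr => i _ /=.
by rewrite -!scalemxAr dotZl dotZr !mxE; ring.
Qed.

End RealCoordinates.

Section SpectralNorm.
Variables (R : realType) (K : field_kind) (n : nat).
Local Notation F := (base_field R K).
Local Notation inj := (@of_real R K).
Implicit Types (A Z : 'M[F]_n) (u v w : 'cV[F]_n).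

Lemma full_coordinates : (0 < n)%N ->
  exists m (f : 'rV[R]_m -> 'cV[F]_n) (x0 : 'rV[R]_m),
  [/\ real_linear f, forall x, f x = 0 -> x = 0, forall v, exists x, f x = v & x0 != 0].
Proof.
move=> n0; have [f [fl fi fs]] := real_coordinates (fullv : {vspace 'cV[F]_n}).
have surj v : exists x, f x = v by apply/fs; rewrite memvf.
have [x0 x0P] := surj (const_mx 1).
exists _, f, x0; split=> //; apply/eqP => x00; move: x0P; rewrite x00 (real_linear0 fl).
by move/colP/(_ (Ordinal n0)) => /eqP; rewrite !mxE eq_sym oner_eq0.
Qed.

(** The maximum in the definition of the spectral norm exists, by [max_ratio]
    applied to the squared norms of [A v] and [v]; hence the default value of
    [setmax] never intervenes. *)
Lemma spectral_norm_attained A : (0 < n)%N ->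
  exists v, [/\ dot v v = 1, dot (A *m v) (A *m v) = spectral_norm A ^+ 2
    & forall w, dot (A *m w) (A *m w) <= spectral_norm A ^+ 2 * dot w w].
Proof.
move=> /full_coordinates[m [f [x0 [fl fi fs x00]]]].
have [P PE] := pullback_qform 1%:M 1%:M fl; have [Q QE] := pullback_qform A A fl.
have {}PE x : dot (f x) (f x) = qform P x by rewrite -PE !mul1mx.
have f0 x : x != 0 -> f x != 0 by apply: contraNneq => /fi ->.
have P0 x : x != 0 -> 0 < qform P x by move=> /f0/dot_gt0; rewrite PE.
have [x x0' xmax] := max_ratio Q x00 P0.
have [c c0 vv] := normalize_unit (f0 x x0').
set v := inj c *: f x in vv.
have vmax w : dot (A *m w) (A *m w) <= dot (A *m v) (A *m v) * dot w w.
  have [y <-] := fs w; rewrite QE PE -scalemxAr dotZl dotZr QE.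
  have := xmax y; rewrite mulrA -expr2.
  have c2 : c ^+ 2 * qform P x = 1 by rewrite -PE -vv /v dotZl dotZr expr2 mulrA.
  have c20 : 0 < c ^+ 2 by rewrite lt_def sqr_ge0 sqrf_eq0 c0.
  have Px : qform P x = (c ^+ 2)^-1.
    by apply: (mulfI (x := c ^+ 2)); rewrite ?gt_eqF // c2 divff ?gt_eqF.
  rewrite Px ler_pdivrMr // => yx; apply: le_trans yx _.
  by rewrite mulrC mulrA.
have sE : spectral_norm A = l2norm (A *m v).
  apply: setmaxE; split; first by exists v => //; exact/l2norm_eq1.
  by move=> _ [w /l2norm_eq1 ww <-]; rewrite l2norm_le; have := vmax w; rewrite ww mulr1.
by exists v; split; rewrite // sE l2norm_sqr.
Qed.

End SpectralNorm.

(** * Maximal right singular vectors *)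

Section SingularSpace.
Variables (R : realType) (K : field_kind) (n : nat).
Local Notation F := (base_field R K).
Local Notation inj := (@of_real R K).
Implicit Types (A Z : 'M[F]_n) (u v w : 'cV[F]_n).

Lemma spectral_norm_ge0 A : 0 <= spectral_norm A.
Proof.
rewrite /spectral_norm /setmax; case: xgetP => // _ -> [[v _ <-] _].
exact: l2norm_ge0.
Qed.

(** The form [s |v|^2 - |A v|^2] is positive semidefinite and vanishes at [v],
    so its gradient at [v], which is proportional to [g], is zero: otherwise a
    small step against [g] would make the form negative. *)
Lemma gram_eigenvector A s v :
    (forall w, dot (A *m w) (A *m w) <= s * dot w w) ->
    s * dot v v <= dot (A *m v) (A *m v) ->
  adjointmx A *m (A *m v) = inj s *: v.
Proof.
move=> le ge; pose g := inj s *: v - adjointmx A *m (A *m v).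
suff gg0 : dot g g = 0 by apply/esym/subr0_eq/dot_eq0.
have gg : dot g g = s * dot v g - dot (A *m v) (A *m g).
  by rewrite {1}/g dotDl dotNl dotZl (dotC (adjointmx A *m _)) -dot_adjoint (dotC (A *m g)).
set b := dot g g in gg *; have b0 : 0 <= b by exact: dot_ge0.
pose C := s * b - dot (A *m g) (A *m g).
have C0 : 0 <= C by rewrite subr_ge0 le.
have quad t : 0 <= 2 * t * b + t ^+ 2 * C.
  have := le (v + inj t *: g); rewrite mulmxDr -scalemxAr !dotDl !dotDr !dotZl !dotZr.
  rewrite -/b (dotC g v) (dotC (A *m g) (A *m v)) /C; move: gg ge; nra.
have := quad (- b / (C + 1)).
have C1p : 0 < C + 1 by lra.
have C1 : C + 1 != 0 by rewrite gt_eqF.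
have C2 : 0 < C + 2 by lra.
have -> : 2 * (- b / (C + 1)) * b + (- b / (C + 1)) ^+ 2 * C =
  - (b ^+ 2 * (C + 2) / (C + 1) ^+ 2) by field.
rewrite oppr_ge0 pmulr_lle0 ?invr_gt0 ?exprn_gt0 // pmulr_lle0 // => b2.
apply/eqP; rewrite -sqrf_eq0.
by rewrite eq_le b2 sqr_ge0.
Qed.

Lemma max_right_singular_spaceP A v : 0 < spectral_norm A ->
  v \in max_right_singular_space A <->
  adjointmx A *m (A *m v) = inj (spectral_norm A ^+ 2) *: v.
Proof.
set s := spectral_norm A => s0.
have is0 : inj s != 0 by rewrite fmorph_eq0 gt_eqF.
rewrite /max_right_singular_space; split=> [/spansetP[vs [vsP vsv]]|vE].
  rewrite (coord_span (X := in_tuple vs) vsv).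
  rewrite !mulmx_sumr scaler_sumr; apply: eq_bigr => i _.
  have [|u [_ _ Av Au]] := vsP vs`_i; first by rewrite mem_nth.
  by rewrite -!scalemxAr Av -scalemxAr Au !scalerA rmorphXn expr2 -mulrA mulrC.
have [->|/normalize_unit[c c0 vv]] := eqVneq v 0; first exact: mem0v.
have ic0 : inj c != 0 by rewrite fmorph_eq0.
set w := inj c *: v in vv.
have wE : adjointmx A *m (A *m w) = inj (s ^+ 2) *: w.
  by rewrite -!scalemxAr vE !scalerA mulrC.
apply/spansetP; exists [:: w]; split.
  move=> x; rewrite inE => /eqP ->; exists ((inj s)^-1 *: (A *m w)); split.
  - apply/l2norm_eq1; rewrite -fmorphV dotZl dotZr dot_adjoint wE dotZr vv.
    by rewrite mulr1 -/s; field; rewrite gt_eqF.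
  - exact/l2norm_eq1.
  - by rewrite scalerA divff // scale1r.
  - by rewrite -scalemxAr wE scalerA rmorphXn expr2 mulKf.
have -> : v = (inj c)^-1 *: w by rewrite scalerA mulVf // scale1r.
by rewrite memvZ // memv_span // inE.
Qed.

End SingularSpace.

(** * First-order optimality and common zeros *)

Section Approximation.
Variables (R : realType) (K : field_kind) (n : nat).
Local Notation F := (base_field R K).
Local Notation inj := (@of_real R K).
Variables (X : {vspace 'M[F]_n}) (Y Xs : 'M[F]_n).
Hypotheses (YnotinX : Y \notin X) (best : spectral_approximation X Y Xs).
Local Notation A := (Y - Xs).
Local Notation s := (spectral_norm (Y - Xs)).
Local Notation E := (max_right_singular_space (Y - Xs)).

Lemma size_gt0 : (0 < n)%N.
Proof.
rewrite lt0n; apply: contraNneq YnotinX => n0; rewrite (_ : Y = 0) ?mem0v //.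
by apply/matrixP => i; have := ltn_ord i; rewrite {2}n0.
Qed.

Lemma residual_gt0 : 0 < s.
Proof.
have [v [vv Av le]] := spectral_norm_attained A size_gt0.
rewrite lt_def spectral_norm_ge0 andbT.
apply: contraNneq YnotinX => s0; have [XsX _] := best.
suff -> : Y = Xs by [].
apply/subr0_eq/matrixP => i j; have /dot_eq0 : dot (A *m delta_mx j 0) (A *m delta_mx j 0) = 0.
  by apply/eqP; rewrite eq_le dot_ge0 andbT; have := le (delta_mx j 0); rewrite s0 expr0n mul0r.
by rewrite -colE => /colP/(_ i); rewrite !mxE.
Qed.

Lemma residual_singularP v : s ^+ 2 * dot v v <= dot (A *m v) (A *m v) -> v \in E.
Proof.
move=> ge; apply/max_right_singular_spaceP; first exact: residual_gt0.
by apply: gram_eigenvector ge; case: (spectral_norm_attained A size_gt0) => ? [].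
Qed.

Lemma residual_singular_norm v : v \in E -> dot (A *m v) (A *m v) = s ^+ 2 * dot v v.
Proof.
by move/(max_right_singular_spaceP _ residual_gt0) => vE; rewrite dot_adjoint vE dotZr.
Qed.

(** For [t > 0] the matrix [Xstar + t Z] approximates [Y] no better than [Xstar],
    so some unit vector [v] has
    [s^2 <= |A v|^2 - 2 t dot (A v) (Z v) + t^2 |Z v|^2].  In real
    coordinates this is the hypothesis of [first_order_zero] with
    [P v = s^2 |v|^2 - |A v|^2]. *)
Lemma descent_blocked Z : Z \in X ->
  exists2 v, v \in E & v != 0 /\ dot (A *m v) (Z *m v) <= 0.
Proof.
move=> ZX; have [m [f [x0 [fl fi fs x00]]]] := full_coordinates R K size_gt0.
have [I0 IE] := pullback_qform 1%:M 1%:M fl; have [G GE] := pullback_qform A A fl.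
have [H HE] := pullback_qform A Z fl; have [D DE] := pullback_qform Z Z fl.
have {}IE x : dot (f x) (f x) = qform I0 x by rewrite -IE !mul1mx.
have f0 x : x != 0 -> f x != 0 by apply: contraNneq => /fi ->.
have [_ [_ _ le]] := spectral_norm_attained A size_gt0.
have PE x : qform (s ^+ 2 *: I0 - G) x = s ^+ 2 * dot (f x) (f x) - dot (A *m f x) (A *m f x).
  by rewrite qformD qformN qformZm IE GE.
have [t t0|x|x xn0] := @first_order_zero R m (s ^+ 2 *: I0 - G) H D; last 1 first.
- rewrite PE -HE subr_le0 => -[/residual_singularP fxE fxZ].
  by exists (f x) => //; split=> //; exact: f0.
- have [XsX [_ smin]] := best.
  have Zt : Xs + inj t *: Z \in X by rewrite memvD ?memvZ.
  have [v [vv Bv _]] := spectral_norm_attained (Y - (Xs + inj t *: Z)) size_gt0.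
  have ge : s ^+ 2 <= spectral_norm (Y - (Xs + inj t *: Z)) ^+ 2.
    by rewrite lerXn2r ?nnegrE ?spectral_norm_ge0 // smin //; exists (Xs + inj t *: Z).
  have [x fx] := fs v; exists x.
    apply/eqP => xz; move: vv; rewrite -fx IE xz -(scale0r 0) qformZ expr0n mul0r.
    by move/eqP; rewrite eq_sym oner_eq0.
  rewrite PE fx vv -HE -DE fx.
  move: Bv ge; rewrite opprD addrA mulmxBl -scalemxAl => <-.
  rewrite !dotDl !dotDr !dotNl !dotNr !dotZl !dotZr (dotC (Z *m v)); nra.
- by rewrite PE subr_ge0.
Qed.

(** A vector [v] at which moving [Xs] inside [X] does not change the length of
    the residual [A v] to first order. *)
Definition stationary v :=
  [/\ v \in E, v != 0 & forall Z, Z \in X -> dot (A *m v) (Z *m v) = 0].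

(** Orthogonality makes [Xs] an optimal choice for the inner minimum at [v].
    At any unit vector the inner minimum is at most [s]: either
    [Xs] competes in it, or [setmin] takes its default value [0]. *)
Lemma max_min_eq_min_max v : stationary v ->
  setmax [set setmin [set l2norm ((Y - Z) *m v) | Z in [set` X]]
         | v in @unit_sphere R K n]
  = setmin [set setmax [set l2norm ((Y - Z) *m v) | v in @unit_sphere R K n]
           | Z in [set` X]].
Proof.
move=> [vE v0 orth]; have [XsX sopt] := best.
rewrite [RHS](setminE sopt).
have s0 := residual_gt0; have [_ [_ _ le]] := spectral_norm_attained A size_gt0.
have norm_s w : dot w w = 1 -> w \in E -> l2norm (A *m w) = s.
  move=> ww wE; apply/eqP; rewrite -(@eqrXn2 _ 2) ?l2norm_ge0 ?(ltW s0) //.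
  by rewrite l2norm_sqr residual_singular_norm // ww mulr1.
apply: setmaxE; split.
  have [c c0 ww] := normalize_unit v0; set w := inj c *: v in ww.
  have wE : w \in E by exact: memvZ.
  exists w; first exact/l2norm_eq1.
  apply: setminE; split; first by exists Xs => //; exact: norm_s.
  move=> _ [Z /= ZX <-]; rewrite -(norm_s w) // l2norm_le.
  have -> : (Y - Z) *m w = A *m w + (Xs - Z) *m w by rewrite -mulmxDl addrA subrK.
  have o : dot (A *m w) ((Xs - Z) *m w) = 0.
    by rewrite -!scalemxAr dotZl dotZr orth ?mulr0 // memvB.
  rewrite !dotDl !dotDr (dotC ((Xs - Z) *m w) (A *m w)) o add0r addr0.
  by rewrite lerDl dot_ge0.
move=> _ [w /l2norm_eq1 ww <-]; rewrite /setmin.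
case: xgetP => [m -> [_ mlb]|_]; last exact: ltW.
apply: le_trans (mlb _ _) _; first by exists Xs.
rewrite -(@ler_pXn2r _ 2) ?nnegrE ?l2norm_ge0 ?(ltW s0) //.
by rewrite l2norm_sqr (le_trans (le _)) // ww mulr1.
Qed.

(** On the line [E] spanned by [v0], [dot (A v) (Z v)] is a nonnegative multiple
    of [dot (A v0) (Z v0)], which is therefore [<= 0] both for [Z] and
    for [- Z]. *)
Lemma stationary_of_line : \dim E = 1%N ->
  exists v, stationary v.
Proof.
move=> dimE; exists (vpick E).
have v0 : vpick E != 0 by rewrite vpick0 -dimv_eq0 dimE.
have /eqP EE : <[vpick E]>%VS == E by rewrite eqEdim -memvE memv_pick dimE dim_vline v0.
split=> //; first exact: memv_pick.
have le Z : Z \in X -> dot (A *m vpick E) (Z *m vpick E) <= 0.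
  move=> /descent_blocked[u]; rewrite -EE => /vlineP[c ->] [].
  rewrite scaler_eq0 negb_or => /andP[c0 _].
  rewrite EE -!scalemxAr dotZZ pmulr_rle0 // lt_def conj_mul_ge0 andbT.
  by apply: contraNneq c0 => /conj_mul_eq0 ->.
move=> Z ZX; apply/eqP; rewrite eq_le le //=.
by rewrite -oppr_le0 -dotNr -mulNmx le // memvN.
Qed.

Lemma stationary_of_one Z1 : Z1 \in X ->
    (forall Z, Z \in X -> exists a, Z = inj a *: Z1) ->
  exists v, stationary v.
Proof.
move=> Z1X XE; have [f [fl fi fs]] := real_coordinates E.
have [Q QE] := pullback_qform A Z1 fl.
have [a|x x0] := @single_zero _ _ Q.
  have [|v /fs[x <-] [fx0 le]] := @descent_blocked (inj a *: Z1); first exact: memvZ.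
  exists x; first by apply: contraNneq fx0 => ->; rewrite real_linear0.
  by rewrite -QE; move: le; rewrite -scalemxAl dotZr.
rewrite -QE => o; exists (f x); split.
- by apply/fs; exists x.
- by apply: contraNneq x0 => /fi ->.
- by move=> _ /XE[a ->]; rewrite -scalemxAl dotZr o mulr0.
Qed.

Lemma stationary_of_two Z1 Z2 : Z1 \in X -> Z2 \in X ->
    (forall Z, Z \in X -> exists a b, Z = inj a *: Z1 + inj b *: Z2) ->
    (2 < real_degree K * \dim E)%N ->
  exists v, stationary v.
Proof.
move=> Z1X Z2X XE m2; have [f [fl fi fs]] := real_coordinates E.
have [Q1 Q1E] := pullback_qform A Z1 fl; have [Q2 Q2E] := pullback_qform A Z2 fl.
have [a b|x x0] := @common_zero _ _ Q1 Q2 m2.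
  have [|v /fs[x <-] [fx0 le]] := @descent_blocked (inj a *: Z1 + inj b *: Z2).
    by rewrite memvD ?memvZ.
  exists x; first by apply: contraNneq fx0 => ->; rewrite real_linear0.
  by rewrite -Q1E -Q2E; move: le; rewrite (mulmxDl (_ *: Z1)) -!scalemxAl dotDr !dotZr.
rewrite -Q1E -Q2E => -[o1 o2]; exists (f x); split.
- by apply/fs; exists x.
- by apply: contraNneq x0 => /fi ->.
- move=> _ /XE[a [b ->]]; rewrite (mulmxDl (_ *: Z1)) -!scalemxAl dotDr !dotZr.
  by rewrite o1 o2 !mulr0 addr0.
Qed.

End Approximation.

Theorem corollary20 (R : realType) (K : field_kind) (n k : nat)
    (Xs : k.-tuple 'M[base_field R K]_n) (X : {vspace 'M[base_field R K]_n})
    (Y Xstar : 'M[base_field R K]_n)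
    (spanX : X = <<Xs>>%VS) (dimX : \dim X = k) (YnotinX : Y \notin X)
    (Xstar_approx : spectral_approximation X Y Xstar) :
  [\/ k = 1%N,
      \dim (max_right_singular_space (Y - Xstar)) = 1%N |
      [/\ k = 2%N, K = OverReals &
          (3 <= \dim (max_right_singular_space (Y - Xstar)))%N]] ->
  setmax [set setmin [set l2norm ((Y - Z) *m v) | Z in [set` X]]
         | v in @unit_sphere R K n]
  = setmin [set setmax [set l2norm ((Y - Z) *m v) | v in @unit_sphere R K n]
           | Z in [set` X]].
Proof.
move: dimX => _ cases.
suff [v vst] : exists v, stationary X Y Xstar v by exact: max_min_eq_min_max vst.
have [dim1|dimN1] := eqVneq (\dim (max_right_singular_space (Y - Xstar))) 1%N.
  exact: stationary_of_line.
have Xs_in i : (i < k)%N -> Xs`_i \in X.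
  by move=> ik; rewrite spanX memv_span // mem_nth // size_tuple.
(* Coordinates are indexed by nat, so that k can be replaced by a numeral. *)
have expand Z : Z \in X ->
    exists c : nat -> base_field R K, Z = \sum_(i < k) c i *: Xs`_i.
  rewrite spanX => /coord_span ->.
  exists (fun i => if insub i is Some j then coord Xs j Z else 0).
  by apply: eq_bigr => i _; rewrite valK.
case: cases => [k1|d1|[k2 KR d3]]; last 1 first.
- subst K k; apply: (@stationary_of_two _ _ _ _ _ _ _ _ Xs`_0 Xs`_1); rewrite ?Xs_in //.
    move=> Z /expand[c ->]; exists (c 0%N), (c 1%N).
    by rewrite !big_ord_recl big_ord0 addr0.
  by rewrite mul1n.
- subst k; case: K Xs X Y Xstar spanX YnotinX Xstar_approx dimN1 Xs_in expand
    => Xs X Y Xstar spanX YnotinX Xstar_approx dimN1 Xs_in expand.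
    apply: (@stationary_of_one _ _ _ _ _ _ _ _ Xs`_0); rewrite ?Xs_in //.
    by move=> Z /expand[c ->]; exists (c 0%N); rewrite big_ord1.
  (* The complex line X is a real plane. *)
  apply: (@stationary_of_two _ _ _ _ _ _ _ _ Xs`_0 ('i%C *: Xs`_0));
    rewrite ?memvZ ?Xs_in //.
    move=> Z /expand[c ->]; exists (complex.Re (c 0%N)), (complex.Im (c 0%N)).
    by rewrite big_ord1 scalerA -scalerDl {1}(complexE (c 0%N)) mulrC.
  have [v vE [v0 _]] := descent_blocked YnotinX Xstar_approx (mem0v _).
  have : \dim (max_right_singular_space (Y - Xstar)) != 0%N.
    by rewrite dimv_eq0; apply: contraNneq v0 => E0; rewrite -memv0 -E0.
  by move: dimN1; case: (\dim _) => [|[|d]] // _ _; rewrite /= mul2n !doubleS.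
- by rewrite d1 eqxx in dimN1.
Qed.
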